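(* Let $n,r,t,s$ be integers with $n/r-t$ a nonnegative integer, and let $m$ be an integer with $n\ge m>(r(r-1)(s-1)+rt)^2$ such that a Hadamard matrix of size $m$ exists. Then \[ \chi\left[KH\left(n,r,\tfrac nr-t,s\right)\right]\le 2m. \]
   Context: The generalized Kneser hypergraph $KH(n,r,k,s)$ has vertex set $\binom{[n]}{k}$ (all $k$-element subsets of $[n]=\{1,\dots,n\}$) and hyperedges all $r$-element sets $\{v_1,\dots,v_r\}$ of vertices such that $|v_i\cap v_j|<s$ for all $i\ne j$. Its chromatic number $\chi$ is the minimum number of colors in a coloring of the vertices with no monochromatic hyperedge. A Hadamard matrix of size $m$ is an $m\times m$ matrix with entries $\pm1$ whose rows are mutually orthogonal. *)

(* Defs.v *)
From mathcomp Require Import all_boot all_order all_algebra.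

Set Implicit Arguments.
Unset Strict Implicit.
Unset Printing Implicit Defensive.

Import Order.TTheory GRing.Theory Num.Theory.

Section Hypergraph.
Variable V : finType.
Implicit Type E : {set {set V}}.

Definition monochromatic (C : finType) (f : V -> C) (e : {set V}) : bool :=
  [forall x in e, forall y in e, f x == f y].

Definition colorable E (c : nat) : bool :=
  [exists f : {ffun V -> 'I_c}, [forall e in E, ~~ monochromatic f e]].

(* When every hyperedge has at least two vertices, #|V| colors suffice, so it
   is enough to minimize over c <= #|V|; chromatic_numberP shows that the
   result is then the least c such that E is c-colorable. (If E has a
   hyperedge with at most one vertex, no coloring exists and the value #|V| is
   meaningless.) *)
Definition chromatic_number E : nat :=
  [arg min_(c < @ord_max #|V| | colorable E c) c].

Lemma colorable_card E :
  (forall e, e \in E -> 1 < #|e|) -> colorable E #|V|.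
Proof.
move=> hE; apply/existsP; exists [ffun x => enum_rank x].
apply/forall_inP => e eE; apply/negP => /forall_inP mono.
have /card_gt1P [x [y [xe ye /negP]]] := hE e eE; apply.
have /forall_inP /(_ y ye) := mono x xe.
by rewrite !ffunE => /eqP /enum_rank_inj ->.
Qed.

Lemma chromatic_numberP E :
  (forall e, e \in E -> 1 < #|e|) ->
  colorable E (chromatic_number E) /\
  (forall c, colorable E c -> chromatic_number E <= c).
Proof.
move=> hE; rewrite /chromatic_number.
case: arg_minnP => [|i iE imin]; first exact: colorable_card.
split=> // c cE; have [cV|Vc] := leqP c #|V|.
  by have := imin (Ordinal (cV : c < #|V|.+1)); apply.
by apply: leq_trans (ltnW Vc); rewrite -ltnS.
Qed.

End Hypergraph.

Notation ksubset n k := {A : {set 'I_n} | #|A| == k}.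

Definition KH (n r k : nat) (s : int) : {set {set ksubset n k}} :=
  [set e : {set ksubset n k} | (#|e| == r) &&
    [forall A in e, forall B in e,
      (A != B) ==> ((#|val A :&: val B|%:Z)%R < s)%R]].

Lemma KH_card (n r k : nat) (s : int) (e : {set ksubset n k}) :
  e \in KH n r k s -> #|e| = r.
Proof. by rewrite inE => /andP [/eqP]. Qed.

Definition hadamard (m : nat) (H : 'M[int]_m) : Prop :=
  (forall i j, H i j = 1%R \/ H i j = (-1)%R) /\
  (forall i j, i != j -> (\sum_(l < m) H i l * H j l = 0)%R).

(* Main.v *)
(** For a [k]-set [A], let [u_A = r 1_A - 1] on the first [m] points, and colour
    [A] by a row [H_i] with [|<H_i, u_A>|] at least [sqrt m], together with the
    sign of [<H_i, u_A>]. Such a row exists by Parseval, since all entries of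
    [u_A] have absolute value at least 1. If [A_1, ..., A_r] share a colour and
    [d l] is the number of the [A_j] that contain [l], then
    [r sqrt m <= |sum_j <H_i, u_(A_j)>| <= r sum_l |d l - 1|], whereas
    [|d - 1| <= d (d - 1) - (d - 1)] and double counting give
    [sum_l |d l - 1| <= r (r - 1) (s - 1) + r t]. *)
Require Import Defs.
From mathcomp Require Import all_boot all_order all_algebra.
From mathcomp Require Import zify.

Set Implicit Arguments.
Unset Strict Implicit.
Unset Printing Implicit Defensive.

Import Order.TTheory GRing.Theory Num.Theory.

Lemma colorable_finType (V C : finType) (E : {set {set V}}) (f : V -> C) :
  (forall e, e \in E -> ~~ monochromatic f e) -> colorable E #|C|.
Proof.
move=> fE; apply/existsP; exists [ffun x => enum_rank (f x)].
apply/forall_inP => e eE; apply: contra (fE e eE) => /forall_inP mono.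
apply/forall_inP => x xe; apply/forall_inP => y ye.
have /forall_inP /(_ y ye) := mono x xe.
by rewrite !ffunE => /eqP /enum_rank_inj ->.
Qed.

Section Hadamard.
Local Open Scope ring_scope.

(** Row orthogonality says that [H^T / m] is a right inverse of [H] over [rat]. For square matrices
    it is then also a left inverse, and the identity descends to [int] by injectivity of the
    embedding. *)
Lemma hadamard_tr_mul (m : nat) (H : 'M[int]_m) :
  (0 < m)%N -> hadamard H -> H^T *m H = m%:R%:M.
Proof.
move=> m_gt0 [Hpm Horth].
have HHt : H *m H^T = m%:R%:M.
  apply/matrixP => i j; rewrite !mxE; case: eqVneq => [->|ij].
    rewrite (eq_bigr (fun=> 1)) ?sumr_const ?card_ord ?mulr1n // => l _.
    by rewrite mxE; case: (Hpm j l) => ->.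
  by rewrite mulr0n -[RHS](Horth i j ij); apply: eq_bigr => l _; rewrite mxE.
pose f : {rmorphism int -> rat} := intr.
have m_neq0 : m%:R != 0 :> rat by rewrite pnatr_eq0 -lt0n.
have inj_f : injective (map_mx f : 'M_m -> 'M_m).
  move=> A B /matrixP eqAB; apply/matrixP => i j; apply: (@intr_inj rat).
  by have := eqAB i j; rewrite !mxE.
apply: inj_f; rewrite map_mxM map_scalar_mx rmorph_nat.
have : map_mx f H *m (m%:R^-1 *: map_mx f H^T) = 1%:M.
  rewrite -scalemxAr -map_mxM HHt map_scalar_mx rmorph_nat scale_scalar_mx.
  by rewrite mulVf.
move/mulmx1C; rewrite -scalemxAl => /(congr1 ( *:%R m%:R)).
by rewrite scalerA mulfV // scale1r scale_scalar_mx mulr1.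
Qed.

Lemma hadamard_parseval (m : nat) (H : 'M[int]_m) (u : 'cV[int]_m) :
  (0 < m)%N -> hadamard H ->
  \sum_i (H *m u) i 0 ^+ 2 = m%:R * \sum_l u l 0 ^+ 2.
Proof.
move=> m_gt0 hH.
have sqE (v : 'cV[int]_m) : \sum_i v i 0 ^+ 2 = (v^T *m v) 0 0.
  by rewrite mxE; apply: eq_bigr => i _; rewrite mxE expr2.
rewrite !sqE trmx_mul mulmxA -(mulmxA u^T) hadamard_tr_mul //.
by rewrite mul_mx_scalar -scalemxAl mxE.
Qed.

(** If all [m] squares were below [m], their sum would be below [m * m], while Parseval makes it at
    least [m * m]. *)
Lemma hadamard_large_row (m : nat) (H : 'M[int]_m) (u : 'cV[int]_m) :
  (0 < m)%N -> hadamard H -> (forall l, 1 <= u l 0 ^+ 2) ->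
  exists i, m%:Z <= (H *m u) i 0 ^+ 2.
Proof.
move=> m_gt0 hH u_ge1; apply/existsP; apply: contraT.
rewrite negb_exists => /forallP small.
suff : m%:Z * m%:Z < m%:Z * m%:Z by rewrite ltxx.
have sum_m (c : int) : \sum_(i < m) c = m%:Z * c.
  by rewrite sumr_const card_ord -mulr_natl natz.
have lower : m%:Z * m%:Z <= m%:R * \sum_l u l 0 ^+ 2.
  rewrite natz ler_wpM2l //.
  by rewrite -[leLHS]mulr1 -sum_m; apply: ler_sum.
apply: le_lt_trans lower _; rewrite -(hadamard_parseval u m_gt0 hH) -[ltRHS]sum_m.
apply: ltr_sum => [|i _]; last by rewrite ltNge.
by apply/hasP; exists (Ordinal m_gt0); rewrite ?mem_index_enum.
Qed.

End Hadamard.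

Section Degree.
Local Open Scope ring_scope.

Definition degree (T : finType) (V : finType) (X : V -> {set T})
    (e : {set V}) (l : T) : nat := #|[set A in e | l \in X A]|.

Lemma sum_mem_degree (T V : finType) (X : V -> {set T}) (e : {set V}) l :
  (\sum_(A in e) (l \in X A) = degree X e l)%N.
Proof.
rewrite /degree -sum1_card [RHS](eq_bigl (fun A => (A \in e) && (l \in X A))).
  by rewrite big_mkcondr; apply: eq_bigr => A _; case: (l \in X A).
by move=> A; rewrite inE.
Qed.

Lemma sum_card_mem (T : finType) (B : {set T}) : (\sum_l (l \in B) = #|B|)%N.
Proof.
by rewrite -sum1_card [RHS]big_mkcond; apply: eq_bigr => l _; case: ifP.
Qed.

Lemma sum_degree (T V : finType) (X : V -> {set T}) (e : {set V}) :
  (\sum_l degree X e l = \sum_(A in e) #|X A|)%N.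
Proof.
under eq_bigr do rewrite -sum_mem_degree.
by rewrite exchange_big; apply: eq_bigr => A _; apply: sum_card_mem.
Qed.

(** Both sides count triples [(l, A, B)] with [l] in [X A] and in [X B], the diagonal [A = B]
    included. *)
Lemma sum_degree_sqr (T V : finType) (X : V -> {set T}) (e : {set V}) :
  (\sum_l degree X e l ^ 2 = \sum_(A in e) \sum_(B in e) #|X A :&: X B|)%N.
Proof.
under eq_bigr => l _.
  rewrite -sum_mem_degree -mulnn big_distrl /=.
  under eq_bigr do rewrite big_distrr /=.
  over.
rewrite exchange_big; apply: eq_bigr => A _.
rewrite exchange_big; apply: eq_bigr => B _.
rewrite -sum_card_mem; apply: eq_bigr => l _.
by rewrite inE mulnb.
Qed.

Lemma sum_degree_deviation (n r k : nat) (t s : int) (e : {set ksubset n k}) :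
  (k%:R = n%:R / r%:R - t%:~R :> rat) -> (1 < r)%N -> e \in KH n r k s ->
  \sum_l `|(degree val e l)%:Z - 1|
    <= r%:Z * (r%:Z - 1) * (s - 1) + r%:Z * t.
Proof.
move=> hk hr eKH; have card_e := KH_card eKH.
have hk' : n%:Z = r%:Z * k%:Z + r%:Z * t.
  have r_neq0 : r%:R != 0 :> rat by rewrite pnatr_eq0; lia.
  apply: (@intr_inj rat); rewrite rmorphD /= !rmorphM /= -!pmulrn hk.
  by rewrite mulrDr mulrN subrK mulrC divfK.
move: eKH; rewrite inE => /andP [_ /forall_inP small].
pose d l := degree val e l.
(* The right side is [(d l - 1) ^ 2], expanded so that each term can be summed by double counting;
   an integer is bounded in absolute value by its square. *)
have abs_le l : `|(d l)%:Z - 1| <= (d l ^ 2)%N%:Z - (d l)%:Z - (d l)%:Z + 1.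
  by case: (d l) => [|[|a]] //; nia.
apply: le_trans (ler_sum _ (fun l _ => abs_le l)) _.
rewrite !big_split /= !sumrN sumr_const card_ord natz.
rewrite -!(big_morph Posz PoszD (erefl _)) sum_degree sum_degree_sqr.
have cardX (A : ksubset n k) : #|val A| = k by apply/eqP/(valP A).
have -> : (\sum_(A in e) #|val A| = r * k)%N.
  by under eq_bigr do rewrite cardX; rewrite sum_nat_const card_e.
have pairs : (\sum_(A in e) \sum_(B in e) #|val A :&: val B|)%N%:Z
    <= r%:Z * (k%:Z + (r%:Z - 1) * (s - 1)).
  rewrite (big_morph Posz PoszD (erefl _)).
  have -> : r%:Z * (k%:Z + (r%:Z - 1) * (s - 1))
      = \sum_(A in e) (k%:Z + (r%:Z - 1) * (s - 1)).
    by rewrite sumr_const card_e -mulr_natl natz.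
  (* The diagonal term [B = A] contributes exactly [k]; each of the other [r - 1] terms is at most
     [s - 1]. *)
  apply: ler_sum => A Ae; rewrite (bigD1 A) //= setIid cardX PoszD lerD2l.
  rewrite (big_morph Posz PoszD (erefl _)).
  have -> : (r%:Z - 1) * (s - 1) = \sum_(B in e | B != A) (s - 1).
    rewrite (eq_bigl (mem (e :\ A))); last by move=> B; rewrite !inE andbC.
    rewrite sumr_const -mulr_natl natz; congr (_ * _).
    by have := cardsD1 A e; rewrite Ae card_e; lia.
  apply: ler_sum => B /andP [Be BA].
  have /forall_inP /(_ B Be) := small A Ae.
  by rewrite eq_sym BA /= => ?; lia.
move: (\sum_(A in e) _)%N pairs => S pairs; rewrite PoszM; lia.
Qed.

End Degree.

Theorem theorem3 (n r k m : nat) (t s : int)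
  (hr : 1 < r)
  (hk : (k%:R = n%:R / r%:R - t%:~R :> rat)%R)
  (hmn : m <= n)
  (hm : ((r%:Z * (r%:Z - 1) * (s - 1) + r%:Z * t) ^+ 2 < m%:Z)%R)
  (hH : exists H : 'M[int]_m, hadamard H) :
  chromatic_number (KH n r k s) <= 2 * m.
Proof.
case: hH => H Hhad.
have m_gt0 : 0 < m by rewrite -ltz_nat; apply: le_lt_trans (sqr_ge0 _) hm.
have edge_gt1 e : e \in KH n r k s -> 1 < #|e| by move/KH_card->.
apply: (proj2 (chromatic_numberP edge_gt1)).
have -> : 2 * m = #|{: 'I_m * bool}|.
  by rewrite card_prod card_ord card_bool mulnC.
Local Open Scope ring_scope.
pose w : 'I_m -> 'I_n := widen_ord hmn.
pose u (A : ksubset n k) : 'cV[int]_m :=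
  \col_l (r%:Z * (w l \in val A)%:Z - 1).
(* The entries are [-1] and [r - 1], and [r] is at least 2. *)
have u_ge1 A l : 1 <= u A l 0 ^+ 2.
  by rewrite mxE; case: (w l \in val A); nia.
have [row rowP] := fin_all_exists
  (fun A => hadamard_large_row m_gt0 Hhad (u_ge1 A)).
pose g i A := (H *m u A) i 0.
apply: (@colorable_finType _ _ _ (fun A => (row A, g (row A) A < 0))) => e eE.
apply/negP => /forall_inP mono; have card_e := KH_card eE.
have [A0 A0e] : exists A0, A0 \in e by apply/card_gt0P; rewrite card_e; lia.
pose i := row A0; pose b := g i A0 < 0.
have colE A : A \in e -> row A = i /\ (g i A < 0) = b.
  move=> Ae; have /forall_inP /(_ A0 A0e) /eqP [rowE] := mono A Ae.
  by rewrite rowE.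
pose d l := degree val e l.
set D := (_ + _)%R in hm.
have dev : \sum_l `|(d l)%:Z - 1| <= D by exact: sum_degree_deviation.
(* Since [s] and [t] may be negative, the sign of [D] comes from the edge [e]. It is needed to pass
   from [D ^+ 2 < g i A ^+ 2] to [D < |g i A|]. *)
have D_ge0 : 0 <= D by apply: le_trans dev; apply: sumr_ge0.
(* The weight [r] in [u] matches the size of [e]: at [l] the vectors [u A] add up to
   [r * d (w l) - r]. *)
have sum_g : \sum_(A in e) g i A = r%:Z * \sum_l H i l * ((d (w l))%:Z - 1).
  under eq_bigr do rewrite /g mxE.
  rewrite exchange_big mulr_sumr; apply: eq_bigr => l _ /=.
  rewrite -mulr_sumr mulrCA; congr (_ * _).
  under eq_bigr do rewrite mxE.
  rewrite big_split /= sumr_const -mulr_sumr card_e mulrBr; congr (_ * _ + _).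
    by rewrite /d -sum_mem_degree (big_morph Posz PoszD (erefl _)).
  by rewrite -mulr_natl natz mulrN.
have upper : `|\sum_(A in e) g i A| <= r%:Z * D.
  rewrite sum_g normrM ler_wpM2l //; apply: le_trans (ler_norm_sum _ _ _) _.
  apply: le_trans dev.
  apply: (@le_trans _ _ (\sum_l `|(d (w l))%:Z - 1|)).
    apply: ler_sum => l _; rewrite normrM.
    by case: (proj1 Hhad i l) => ->; rewrite ?normrN1 ?normr1 mul1r.
  (* Passing from the first [m] points to all [n] only adds nonnegative terms. *)
  rewrite -(big_ord_narrow hmn (F := fun l => `|(d l)%:Z - 1|)) big_mkcond.
  by apply: ler_sum => l _; case: ifP.
have lower : r%:Z * D < \sum_(A in e) `|g i A|.
  have -> : r%:Z * D = \sum_(A in e) D.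
    by rewrite sumr_const card_e -mulr_natl natz.
  apply: ltr_sum => [|A Ae].
    by apply/hasP; exists A0; rewrite ?mem_index_enum.
  have := lt_le_trans hm (rowP A).
  by rewrite (proj1 (colE A Ae)) -[ltRHS]real_normK ?num_real // ltr_pXn2r ?nnegrE.
(* The sign component of the colour rules out cancellation: all [g i A] with [A] in [e] share the
   sign recorded by [b]. *)
have sumE : \sum_(A in e) `|g i A| = (-1) ^+ b * \sum_(A in e) g i A.
  rewrite mulr_sumr; apply: eq_bigr => A Ae.
  by rewrite -(proj2 (colE A Ae)) -normrEsign.
have := lt_le_trans lower (le_trans (ler_norm _) _).
by rewrite {1}sumE normrM normr_sign mul1r => /(_ _ upper); rewrite ltxx.
Qed.
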